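(* For all integers $n,r,s,k\ge 0$, $0\le t\le 2$, $0\le u\le 2$, we have \begin{align*} \bar{b}^{9k+3}_{9r+3t+2,\,9s+3u}(9n+3)&\equiv\bar{b}^{9k+6}_{9r+3t+1,\,9s+3u}(9n+3)\equiv 0\pmod{3},\\ \bar{b}^{9k+3}_{9r+3t+2,\,9s+3u+2}(9n+6)&\equiv\bar{b}^{9k+6}_{9r+3t+1,\,9s+3u+1}(9n+6)\equiv 0\pmod{3},\\ \bar{b}^{9k+3}_{9r+3t+2,\,9s+3u+1}(9n+6)&\equiv\bar{b}^{9k+6}_{9r+3t+1,\,9s+3u+2}(9n+6)\equiv 0\pmod{3}. \end{align*}
   Context: Write $f_m=\prod_{i\ge 1}(1-q^{mi})$ for $m\ge 1$, and $f_m^a$ for its $a$-th power. For integers $r,s,k\ge 1$, $\bar{b}^k_{r,s}(n)$ denotes the number of overcolored partition $k$-tuples of $n$: $k$-tuples of partitions of total weight $n$ in which each even part may appear in one of $r$ colors, each odd part may appear in one of $s$ colors, and the first occurrence of each part (of each color) in each component may be overlined. Equivalently, as formal power series in $q$, \[\sum_{n=0}^{\infty}\bar{b}^k_{r,s}(n)q^n=\frac{f_2^{(3s-2r)k}}{f_1^{2sk}f_4^{(s-r)k}}.\] If a lower index is $0$, $\bar{b}^k_{r,s}(n)$ is understood to be defined by this generating function. (The superscript is the number of components of the tuple, not a power.) *)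

(* Defs.v *)
From HB Require Import structures.
From mathcomp Require Import all_boot all_order all_algebra.
From mathcomp Require Import boolp.

Set Implicit Arguments.
Unset Strict Implicit.
Unset Printing Implicit Defensive.

Import GRing.Theory.
Local Open Scope ring_scope.

(* The ring Z[[q]], with eqType and choiceType structures from classical logic. *)
Record fps := Fps { fcoef : nat -> int }.

Lemma fpsP (a b : fps) : (forall n, fcoef a n = fcoef b n) -> a = b.
Proof. by case: a b => [a] [b] /= /funext ->. Qed.

HB.instance Definition _ := gen_eqMixin fps.
HB.instance Definition _ := gen_choiceMixin fps.

Definition fps_const (c : int) : fps := Fps (fun n => if n == 0%N then c else 0).
Definition fps_add (a b : fps) : fps := Fps (fun n => fcoef a n + fcoef b n).
Definition fps_opp (a : fps) : fps := Fps (fun n => - fcoef a n).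
Definition fps_mul (a b : fps) : fps :=
  Fps (fun n => \sum_(i < n.+1) fcoef a i * fcoef b (n - i)).

Lemma fps_addA : associative fps_add.
Proof. by move=> a b c; apply: fpsP => n; apply: addrA. Qed.
Lemma fps_addC : commutative fps_add.
Proof. by move=> a b; apply: fpsP => n; apply: addrC. Qed.
Lemma fps_add0 : left_id (fps_const 0) fps_add.
Proof. by move=> a; apply: fpsP => n /=; rewrite if_same add0r. Qed.
Lemma fps_addN : left_inverse (fps_const 0) fps_opp fps_add.
Proof. by move=> a; apply: fpsP => n /=; rewrite if_same addNr. Qed.

HB.instance Definition _ :=
  GRing.isZmodule.Build fps fps_addA fps_addC fps_add0 fps_addN.

Definition fps_trunc N (a : fps) : {poly int} := \poly_(i < N) fcoef a i.

Lemma fps_mul_trunc N (a b : fps) n : (n < N)%N ->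
  fcoef (fps_mul a b) n = (fps_trunc N a * fps_trunc N b)`_n.
Proof.
move=> nN; rewrite coefM; apply: eq_bigr => i _; rewrite !coef_poly.
by rewrite (leq_ltn_trans (leq_subr _ _) nN) (leq_ltn_trans _ nN) // -ltnS.
Qed.

Lemma coefM_eq_trunc (p p' r : {poly int}) n :
  (forall i, (i <= n)%N -> p`_i = p'`_i) -> (p * r)`_n = (p' * r)`_n.
Proof.
by move=> e; rewrite !coefM; apply: eq_bigr => i _; rewrite e // -ltnS.
Qed.

Lemma fps_mulC : commutative fps_mul.
Proof. by move=> a b; apply: fpsP => n; rewrite !(@fps_mul_trunc n.+1) // mulrC. Qed.

Lemma fps_mulA : associative fps_mul.
Proof.
have H (x y z : fps) n : fcoef (fps_mul (fps_mul x y) z) n =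
    (fps_trunc n.+1 x * fps_trunc n.+1 y * fps_trunc n.+1 z)`_n.
  rewrite (@fps_mul_trunc n.+1) //; apply: coefM_eq_trunc => i lein.
  by rewrite coef_poly ltnS lein (@fps_mul_trunc n.+1).
by move=> a b c; apply: fpsP => n; rewrite fps_mulC !H mulrC mulrA.
Qed.

Lemma fps_mul1 : left_id (fps_const 1) fps_mul.
Proof.
move=> a; apply: fpsP => n /=.
by rewrite big_ord_recl /= mul1r subn0 big1 ?addr0 // => i _; rewrite mul0r.
Qed.

Lemma fps_mulDl : left_distributive fps_mul fps_add.
Proof.
move=> a b c; apply: fpsP => n /=.
by rewrite -big_split /=; apply: eq_bigr => i _; rewrite mulrDl.
Qed.

Lemma fps_const1_neq0 : fps_const 1 != 0.
Proof. by apply/eqP => /(congr1 (fun a => fcoef a 0)). Qed.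

HB.instance Definition _ := GRing.Zmodule_isComNzRing.Build fps
  fps_mulA fps_mulC fps_mul1 fps_mulDl fps_const1_neq0.

Lemma fcoef1 n : fcoef 1 n = (n == 0%N)%:R.
Proof. by case: n. Qed.
Lemma fcoefD a b n : fcoef (a + b) n = fcoef a n + fcoef b n.
Proof. by []. Qed.
Lemma fcoefN a n : fcoef (- a) n = - fcoef a n.
Proof. by []. Qed.
Lemma fcoefM a b n :
  fcoef (a * b) n = \sum_(i < n.+1) fcoef a i * fcoef b (n - i).
Proof. by []. Qed.
Lemma fcoef_const c n : fcoef (fps_const c) n = if n == 0%N then c else 0.
Proof. by []. Qed.

(* With u the inverse of the constant term of a, the inverse of a is
   u * \sum_j (1 - u * a) ^+ j, and only the terms j <= n reach q ^ n. *)
Definition fps_unit : {pred fps} := fun a => fcoef a 0 \is a GRing.unit.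
Definition fps_geom (a : fps) N : fps :=
  let u := fps_const (fcoef a 0)^-1 in u * \sum_(j < N) (1 - u * a) ^+ j.
Definition fps_inv (a : fps) : fps :=
  if a \in fps_unit then Fps (fun n => fcoef (fps_geom a n.+1) n) else a.

Lemma fcoef0M a b : fcoef (a * b) 0 = fcoef a 0 * fcoef b 0.
Proof. by rewrite fcoefM big_ord1. Qed.

Lemma fcoefX_lt (d : fps) j i : fcoef d 0 = 0 -> (i < j)%N -> fcoef (d ^+ j) i = 0.
Proof.
move=> d0; elim: j i => [//|j IH] i ij; rewrite exprS fcoefM.
rewrite big_ord_recl d0 mul0r add0r big1 // => l _.
rewrite IH ?mulr0 // lift0; case: i ij l => [|i] ij l; first by case: l.
by rewrite subSS (leq_ltn_trans (leq_subr _ _)).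
Qed.

Lemma fcoef_sum N (F : nat -> fps) n :
  fcoef (\sum_(j < N) F j) n = \sum_(j < N) fcoef (F j) n.
Proof.
elim: N => [|N IH]; first by rewrite !big_ord0 /= if_same.
by rewrite !big_ord_recr /= IH.
Qed.

Lemma fps_mulVr : {in fps_unit, left_inverse 1 fps_inv *%R}.
Proof.
move=> a ua; rewrite /fps_inv ua mulrC; apply: fpsP => n.
set u := fps_const (fcoef a 0)^-1; set d := 1 - u * a.
have d0 : fcoef d 0 = 0.
  by rewrite /d fcoefD fcoefN fcoef0M fcoef1 fcoef_const /= mulVr ?subrr.
have stab m : (m <= n)%N -> fcoef (fps_geom a m.+1) m = fcoef (fps_geom a n.+1) m.
  move=> mn; rewrite /fps_geom -/u -/d ![u * _]mulrC !fcoefM.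
  apply: eq_bigr => i _; congr (_ * _).
  have im : (i <= m)%N by rewrite -ltnS.
  rewrite !(fcoef_sum _ (fun j => d ^+ j)) -(subnKC mn) -addSn big_split_ord /=.
  rewrite [X in _ + X]big1 ?addr0 // => j _.
  by rewrite fcoefX_lt // addSn ltnS (leq_trans im) // leq_addr.
have -> : fcoef (a * {| fcoef := fun m => fcoef (fps_geom a m.+1) m |}) n
          = fcoef (a * fps_geom a n.+1) n.
  by rewrite !fcoefM; apply: eq_bigr => i _; congr (_ * _); apply: stab; rewrite leq_subr.
have -> : a * fps_geom a n.+1 = 1 - d ^+ n.+1.
  rewrite /fps_geom -/u -/d mulrCA mulrA.
  have -> : u * a = 1 - d by rewrite /d opprB addrC subrK.
  by rewrite -[RHS]opprB subrX1 -mulNr [- (d - 1)]opprB.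
by rewrite fcoefD fcoefN fcoefX_lt // oppr0 addr0.
Qed.

Lemma fps_unitPl a b : b * a = 1 -> a \in fps_unit.
Proof.
move=> /(congr1 (fun x => fcoef x 0)); rewrite fcoef0M fcoef1 => h.
by apply/unitrP; exists (fcoef b 0); split; rewrite // mulrC.
Qed.

Lemma fps_inv_out : {in [predC fps_unit], fps_inv =1 id}.
Proof. by move=> a; rewrite inE /= /fps_inv => /negbTE ->. Qed.

HB.instance Definition _ := GRing.ComNzRing_hasMulInverse.Build fps
  fps_mulVr fps_unitPl fps_inv_out.

(* For m >= 1 the factors with index i > n do not contribute to q ^ n, so the
   coefficient of q ^ n in the infinite product is read off a finite one. *)
Definition eulerf (m : nat) : fps :=
  Fps (fun n => (\prod_(1 <= i < n.+1) (1 - 'X^(m * i) : {poly int}))`_n).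

Lemma eulerf_unit m : eulerf m \is a GRing.unit.
Proof. by rewrite qualifE /= /fps_unit /= big_geq // coef1. Qed.

Definition bbar_gf (k r s : nat) : fps :=
  eulerf 2 ^ ((3 * s%:Z - 2 * r%:Z) * k%:Z) /
  (eulerf 1 ^ (2 * s%:Z * k%:Z) * eulerf 4 ^ ((s%:Z - r%:Z) * k%:Z)).

Definition ncolors (r s i : nat) : nat := if odd i then s else r.

(* Colored parts of size at most n; the index i : 'I_n stands for size i.+1. *)
Definition cpart (r s n : nat) : finType := {i : 'I_n & 'I_(ncolors r s i.+1)}.
Definition cpart_size r s n (x : cpart r s n) : nat := (tag x).+1.

(* A multiset of colored parts, given for each colored part by its multiplicity
   and by whether its first occurrence is overlined.  In a partition of weight
   at most n, parts and multiplicities never exceed n. *)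
Definition opart (r s n : nat) : finType := {ffun cpart r s n -> 'I_n.+1 * bool}.

Definition opart_valid r s n (p : opart r s n) : bool :=
  [forall x, (p x).2 ==> (0 < (p x).1)%N].

Definition opart_weight r s n (p : opart r s n) : nat :=
  (\sum_x cpart_size x * (p x).1)%N.

Definition optuples (k r s n : nat) : {set {ffun 'I_k -> opart r s n}} :=
  [set P : {ffun 'I_k -> opart r s n} |
    [forall j, opart_valid (P j)] && ((\sum_j opart_weight (P j))%N == n)].

(* \bar{b}^k_{r,s}(n): a count for r, s >= 1, and by convention the coefficient
   of the generating function when one of r, s is 0. *)
Definition bbar (k r s n : nat) : int :=
  if (0 < r)%N && (0 < s)%N then #|optuples k r s n|%:Z
  else fcoef (bbar_gf k r s) n.

(* Main.v *)
Require Import Defs.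
From mathcomp Require Import all_boot all_order all_algebra.
From mathcomp Require Import ring zify.

(* Modulo 3 the cube of a power series is obtained by q -> q^3 (Frobenius). With
   k components, 3 | k, the generating function is, up to a factor C^9, the cube
   of f_1^a f_2^b f_4^c where a, b, c are determined modulo 3; choosing them well
   makes this one of
     f_4^2 / f_2 = psi(q^2),   f_2^2 / f_1 = psi(q),   f_1 f_4 / f_2 = psi(-q),
   where psi(q) = sum_j q^(j(j+1)/2) (Gauss). Triangular numbers are never 2
   modulo 3, and their doubles are never 1, so the required coefficients vanish.
   Gauss's identity is the limit of Shanks's finite identity. *)

Section Development.

Set Implicit Arguments.
Unset Strict Implicit.
Unset Printing Implicit Defensive.

Import GRing.Theory.
Local Open Scope ring_scope.

(** * Finite q-products and Shanks's identity *)

(** [poch] and [opoch] are the symbols (x;x)_n and (x;x^2)_n, with x left free for the values q, q^2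
    and -q. *)
Definition poch (R : comUnitRingType) (x : R) n := \prod_(j < n) (1 - x ^+ j.+1).
Definition opoch (R : comUnitRingType) (x : R) n := \prod_(j < n) (1 - x ^+ (2 * j).+1).

Lemma poch_double (R : comUnitRingType) (x : R) n :
  poch x (2 * n) = opoch x n * poch (x ^+ 2) n.
Proof.
rewrite /poch /opoch; elim: n => [|n IH]; first by rewrite !big_ord0 mulr1.
by rewrite mulnS !addSn add0n !big_ord_recr /= IH -exprM mulnS; ring.
Qed.

Lemma unitr_prod_ord (R : comUnitRingType) n (F : 'I_n -> R) :
  (forall i, F i \is a GRing.unit) -> \prod_i F i \is a GRing.unit.
Proof. by move=> h; elim/big_ind: _ => // [|x y hx hy]; rewrite ?unitr1 ?unitrM ?hx. Qed.

(* Shanks (1951): the increment of the left-hand side in n telescopes in s. The term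
   s = 0 is P n and the others are divisible by x^(2n+1), whence Gauss's identity. *)
Lemma shanks_identity (R : comUnitRingType) (x : R) n :
  (forall m, 1 - x ^+ m.+1 \is a GRing.unit) ->
  let P m : R := poch (x ^+ 2) m / opoch x m in
  \sum_(s < n.+1) P n / P s * x ^+ (s * (2 * n).+1)
    = \sum_(k < (2 * n).+1) x ^+ 'C(k.+1, 2).
Proof.
move=> ux P.
have uP m : P m \is a GRing.unit.
  rewrite unitrM unitrV; apply/andP; split; apply: unitr_prod_ord => i.
    by rewrite -exprM mulnS; apply: ux.
  exact: ux.
have PS m : P m.+1 = P m * ((1 - x ^+ (2 * m).+2) / (1 - x ^+ (2 * m).+1)).
  rewrite /P /poch /opoch !big_ord_recr /= -exprM mulnS invrM ?unitr_prod_ord //.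
  by ring.
have iPS m : (P m.+1)^-1 = (P m)^-1 * ((1 - x ^+ (2 * m).+1) / (1 - x ^+ (2 * m).+2)).
  by rewrite PS invrM ?uP ?unitrM ?unitrV ?ux ?ux // invrM ?unitrV ?ux // invrK mulrC.
(* Here A = x^(2n+1), W = x^(2s), X = x^(s(2n+1)), p = P n, ips = 1/P s, d = 1 - x^(2s+2); [ia] and
   [id] invert 1 - A and d. *)
have key (A W X p ips ia d id : R) : (1 - A) * ia = 1 -> d * id = 1 ->
    p * ((1 - A * x) * ia) * ips * (X * W) - p * ips * X
      = p * ia * (X * A * d * (ips * ((1 - W * x) * id)) - X * (1 - W) * ips).
  move=> ha hd; transitivity (p * ia * ips * X * ((1 - A * x) * W - (1 - A))).
    transitivity (p * ((1 - A * x) * ia) * ips * (X * W) - p * ips * X * ((1 - A) * ia)).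
      by rewrite ha mulr1.
    by ring.
  transitivity (p * ia * ips * X * (A * (d * id) * (1 - W * x) - (1 - W))); last by ring.
  by rewrite hd; ring.
elim: n => [|n IH].
  by rewrite !big_ord_recl !big_ord0 !mul0n !expr0 divrr // mulr1.
rewrite big_ord_recr /= divrr // mul1r mulnS !addSn add0n.
rewrite [in RHS]big_ord_recr [in RHS]big_ord_recr /= -IH; clear IH.
(* Of the two new exponents, (n+1)(2n+3) is that of the new term s = n+1; (n+1)(2n+1) must be the
   increment of the old terms. *)
have -> : 'C((2 * n).+3, 2) = (n.+1 * (2 * n).+3)%N by rewrite bin2 /=; lia.
have -> : 'C((2 * n).+2, 2) = (n.+1 * (2 * n).+1)%N by rewrite bin2 /=; lia.
congr (_ + _); apply/eqP; rewrite addrC -subr_eq; apply/eqP; rewrite -sumrB.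
(* Up to the factor P n / a, T is an antidifference of the increment; T 0 = 0 because 1 - x^0 =
   0. *)
set T := fun s => x ^+ (s * (2 * n).+1) * (1 - x ^+ (2 * s)) / P s.
set a := 1 - x ^+ (2 * n).+1.
transitivity (P n / a * (T n.+1 - T 0%N)).
  rewrite -(telescope_sumr T (leq0n n.+1)) big_mkord mulr_sumr.
  apply: eq_bigr => s _.
  rewrite /T /= !iPS !PS -/a.
  have -> : (2 * s.+1 = (2 * s).+2)%N by lia.
  have -> : (s * (2 * n).+3 = s * (2 * n).+1 + 2 * s)%N by lia.
  have -> : (s.+1 * (2 * n).+1 = s * (2 * n).+1 + (2 * n).+1)%N by lia.
  rewrite [x ^+ (2 * n).+2]exprSr.
  rewrite [x ^+ (2 * s).+1]exprSr 2!exprD; apply: key; rewrite divrr ?ux //.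
rewrite /T muln0 expr0 subrr mulr0 mul0r subr0 iPS -/a.
have ua : a * a^-1 = 1 by rewrite divrr ?ux.
have uPn : P n / P n = 1 by rewrite divrr.
have -> : (2 * n.+1 = (2 * n).+2)%N by lia.
have ud : (1 - x ^+ (2 * n).+2) / (1 - x ^+ (2 * n).+2) = 1 by rewrite divrr ?ux.
set X := x ^+ (n.+1 * _).
transitivity (X * (a / a) * (P n / P n) * ((1 - x ^+ (2 * n).+2) / (1 - x ^+ (2 * n).+2))).
  by ring.
by rewrite ua uPn ud !mulr1.
Qed.

(** * Power series modulo q^N *)

Lemma fcoef0X (x : fps) m : fcoef (x ^+ m) 0 = fcoef x 0 ^+ m.
Proof. by elim: m => [|m IH]; rewrite ?expr0 // !exprS fcoef0M IH. Qed.

Lemma fps_unit_coef0 (a : fps) : (a \is a GRing.unit) = (fcoef a 0 \is a GRing.unit).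
Proof. by []. Qed.

Lemma unit_1subX (x : fps) m : fcoef x 0 = 0 -> 1 - x ^+ m.+1 \is a GRing.unit.
Proof. by move=> x0; rewrite fps_unit_coef0 fcoefD fcoefN fcoef0X x0 expr0n subr0. Qed.

(** Congruence modulo q^N; having it for every N replaces a passage to the limit. *)
Definition eqtr N (a b : fps) := forall i, (i < N)%N -> fcoef a i = fcoef b i.

Lemma eqtr_sym N a b : eqtr N a b -> eqtr N b a.
Proof. by move=> h i iN; rewrite h. Qed.

Lemma eqtr_trans N b a c : eqtr N a b -> eqtr N b c -> eqtr N a c.
Proof. by move=> h k i iN; rewrite h ?k. Qed.

Lemma eqtr_le M N a b : (M <= N)%N -> eqtr N a b -> eqtr M a b.
Proof. by move=> MN h i iM; rewrite h // (leq_trans iM). Qed.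

Lemma eqtrM N a b c d : eqtr N a b -> eqtr N c d -> eqtr N (a * c) (b * d).
Proof.
move=> h k i iN; rewrite !fcoefM; apply: eq_bigr => j _.
have := ltn_ord j; rewrite ltnS => ji.
by rewrite h ?k // (leq_ltn_trans _ iN) // leq_subr.
Qed.

Lemma eqtrX N a b k : eqtr N a b -> eqtr N (a ^+ k) (b ^+ k).
Proof. by move=> h; elim: k => [|k IH] //; rewrite !exprS; apply: eqtrM. Qed.

Lemma eqtrV N a b : a \is a GRing.unit -> b \is a GRing.unit ->
  eqtr N a b -> eqtr N a^-1 b^-1.
Proof.
move=> ua ub h; have -> : a^-1 = a^-1 * b^-1 * b by rewrite mulrVK.
have {2}-> : b^-1 = a^-1 * b^-1 * a by rewrite mulrAC mulVr ?mul1r.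
by apply: eqtrM => //; apply: eqtr_sym.
Qed.

Lemma eqtr_prod N n (F G : 'I_n -> fps) : (forall i, eqtr N (F i) (G i)) ->
  eqtr N (\prod_i F i) (\prod_i G i).
Proof. by move=> h; elim/big_ind2: _ => // *; apply: eqtrM. Qed.

Lemma fcoef_mulX_lt (x a : fps) j i : fcoef x 0 = 0 -> (i < j)%N ->
  fcoef (a * x ^+ j) i = 0.
Proof.
move=> x0 ij; rewrite fcoefM big1 // => l _.
by rewrite fcoefX_lt ?mulr0 // (leq_ltn_trans (leq_subr _ _)).
Qed.

(** As x has no constant term, the terms s >= 1 of Shanks's identity vanish below order 2n+1. *)
Lemma eqtr_gauss (x : fps) n : fcoef x 0 = 0 ->
  eqtr n (poch (x ^+ 2) n / opoch x n) (\sum_(k < (2 * n).+1) x ^+ 'C(k.+1, 2)).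
Proof.
move=> x0 i iN; rewrite -shanks_identity; last by move=> m; apply: unit_1subX.
set P := fun m : nat => (poch (x ^+ 2) m / opoch x m : fps).
rewrite (fcoef_sum _ (fun s => P n / P s * x ^+ (s * (2 * n).+1))).
have P0 : P 0%N = 1 by rewrite /P /poch /opoch !big_ord0 divr1.
rewrite big_ord_recl [(nat_of_ord _ * _)%N]mul0n expr0 mulr1 [P ord0]P0 divr1.
rewrite big1 ?addr0 // => s _.
rewrite fcoef_mulX_lt // (leq_trans iN) // lift0; lia.
Qed.

(** * Euler products as limits of finite products *)

Definition qvar : fps := Fps (fun n => (n == 1%N)%:R).

Lemma fcoef_qvarM a n : fcoef (qvar * a) n.+1 = fcoef a n.
Proof.
rewrite fcoefM !big_ord_recl /= mul0r add0r mul1r subSS subn0.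
by rewrite big1 ?addr0 // => i _; rewrite /= mul0r.
Qed.

Lemma fcoef_qvarX m n : fcoef (qvar ^+ m) n = (n == m)%:R.
Proof.
elim: m n => [|m IH] [|n]; rewrite ?expr0 //.
  by rewrite fcoef0X expr0n.
by rewrite exprS fcoef_qvarM IH.
Qed.

Lemma fcoef0_qvarX m : (0 < m)%N -> fcoef (qvar ^+ m) 0 = 0.
Proof. by rewrite fcoef_qvarX; case: m. Qed.

(** The factors 1 - x^(j+1) with j >= M are 1 modulo q^(M+1). *)
Lemma eqtr_poch (x : fps) M N : fcoef x 0 = 0 -> (M <= N)%N ->
  eqtr M.+1 (poch x N) (poch x M).
Proof.
move=> x0; elim: N => [|N IH]; first by rewrite leqn0 => /eqP ->.
rewrite leq_eqVlt => /orP [/eqP -> //|MN].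
rewrite /poch big_ord_recr /= => i iM.
rewrite mulrBr mulr1 fcoefD fcoefN fcoef_mulX_lt ?oppr0 ?addr0; [exact: IH|by []|lia].
Qed.

Lemma eqtr_eulerf m M : (0 < m)%N -> eqtr M.+1 (eulerf m) (poch (qvar ^+ m) M).
Proof.
move=> m0 i iM; have x0 := fcoef0_qvarX m0.
(* [eulerf] is read off products of polynomials; [h] carries these over to power series. *)
have h N n : (\prod_(j < N) (1 - 'X^(m * j.+1)) : {poly int})`_n
    = fcoef (poch (qvar ^+ m) N) n.
  rewrite /poch; elim: N n => [|N IH] n; first by rewrite !big_ord0 fcoef1 coef1.
  rewrite !big_ord_recr [LHS]coefM fcoefM; apply: eq_bigr => j _; rewrite IH.
  by rewrite fcoefD fcoefN fcoef1 -exprM fcoef_qvarX coefB coef1 coefXn.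
by rewrite (@eqtr_poch _ i M) //= big_add1 /= big_mkord h.
Qed.

Lemma unit_opoch (x : fps) n : fcoef x 0 = 0 -> opoch x n \is a GRing.unit.
Proof. by move=> x0; apply: unitr_prod_ord => i; apply: unit_1subX. Qed.

Lemma unit_poch (x : fps) n : fcoef x 0 = 0 -> poch x n \is a GRing.unit.
Proof. by move=> x0; apply: unitr_prod_ord => i; apply: unit_1subX. Qed.

(** Removing the even multiples of m from f_m leaves the odd ones: the infinite product is f_m /
    f_(2m). *)
Lemma eqtr_opoch m M : (0 < m)%N ->
  eqtr M.+1 (opoch (qvar ^+ m) M) (eulerf m / eulerf (2 * m)).
Proof.
move=> m0; have x0 := fcoef0_qvarX m0.
have -> : opoch (qvar ^+ m) M = poch (qvar ^+ m) (2 * M) / poch (qvar ^+ (2 * m)) M.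
  by rewrite poch_double -exprM mulnC mulrK ?unit_poch // fcoef0_qvarX ?muln_gt0.
apply: eqtrM; first by apply/eqtr_sym/(@eqtr_le _ (2 * M).+1); [lia|exact: eqtr_eulerf].
apply: eqtrV; rewrite ?eulerf_unit ?unit_poch ?fcoef0_qvarX ?muln_gt0 //.
by apply/eqtr_sym/eqtr_eulerf; rewrite muln_gt0.
Qed.

(** Odd powers change sign with x, so the factors pair into differences of squares. *)
Lemma opoch_oppr (x : fps) n : opoch (- x) n * opoch x n = opoch (x ^+ 2) n.
Proof.
rewrite /opoch -big_split; apply: eq_bigr => i _ /=.
rewrite exprNn -signr_odd /= oddM /= -exprM expr1 [(2 * _.+1)%N]mulnC exprM; ring.
Qed.

(** * Coefficients of psi(q), psi(q^2) and psi(-q) modulo 3 *)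

(** By Gauss's identity [theta] is the sum of x^T over the triangular numbers T. *)
Lemma fcoef_theta_eq0 (x theta : fps) i : fcoef x 0 = 0 ->
  (forall n, eqtr n theta (poch (x ^+ 2) n / opoch x n)) ->
  (forall k, fcoef (x ^+ 'C(k.+1, 2)) i = 0) -> fcoef theta i = 0.
Proof.
move=> x0 h hk; rewrite (h i.+1) // (eqtr_gauss x0) //.
by rewrite (fcoef_sum _ (fun k => x ^+ 'C(k.+1, 2))) big1.
Qed.

(** A triangular number that is 2 modulo 3 would make k(k+1) equal to 1, but its residues are 0, 2,
    0. *)
Lemma bin2_mod3 k : ('C(k.+1, 2) %% 3 != 2)%N.
Proof.
have e : ('C(k.+1, 2) * 2 = k.+1 * k)%N.
  by rewrite bin2 /= muln2 halfK oddM /=; case: odd; rewrite ?subn0.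
apply/eqP => h; have : (('C(k.+1, 2) * 2) %% 3 = 1)%N by lia.
rewrite e -modnMm; have : (k %% 3 < 3)%N by rewrite ltn_mod.
case E : (k %% 3)%N => [|[|[|//]]] _.
- by rewrite muln0.
- by have -> : (k.+1 %% 3 = 2)%N by lia.
by have -> : (k.+1 %% 3 = 0)%N by lia.
Qed.

(** This is psi(q). The exponent 0 gives the three psi lemmas the common shape that [dvd3_gf]
    takes. *)
Lemma fcoef_psi_q i : (i %% 3 = 2)%N ->
  fcoef (eulerf 1 ^ (-1) * eulerf 2 ^ 2 * eulerf 4 ^ 0) i = 0.
Proof.
move=> hi; apply: (@fcoef_theta_eq0 qvar) => [//|n|k]; last first.
  by rewrite fcoef_qvarX; case: eqP => // ik; have := bin2_mod3 k; rewrite -ik hi.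
rewrite expr0z mulr1 exprN1 -exprnP.
have -> : (eulerf 1)^-1 * eulerf 2 ^+ 2 = eulerf 2 / (eulerf 1 / eulerf 2).
  by rewrite invrM ?unitrV ?eulerf_unit // invrK; ring.
apply: eqtrM; first by apply: (@eqtr_le _ n.+1) => //; apply: eqtr_eulerf.
apply: eqtrV; rewrite ?unit_opoch ?unitrM ?unitrV ?eulerf_unit //.
apply/eqtr_sym; rewrite -[qvar]expr1.
by apply: (@eqtr_le _ n.+1) => //; apply: eqtr_opoch.
Qed.

(** This is psi(q^2): 2T is 1 modulo 3 only if T is 2. *)
Lemma fcoef_psi_q2 i : (i %% 3 = 1)%N ->
  fcoef (eulerf 1 ^ 0 * eulerf 2 ^ (-1) * eulerf 4 ^ 2) i = 0.
Proof.
move=> hi; apply: (@fcoef_theta_eq0 (qvar ^+ 2)) => [|n|k]; last first.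
  rewrite -exprM fcoef_qvarX; case: eqP => // ik; have := bin2_mod3 k; lia.
- rewrite expr0z mul1r exprN1 -exprnP.
  have -> : (eulerf 2)^-1 * eulerf 4 ^+ 2 = eulerf 4 / (eulerf 2 / eulerf 4).
    by rewrite invrM ?unitrV ?eulerf_unit // invrK; ring.
  apply: eqtrM; first by rewrite -exprM; apply: (@eqtr_le _ n.+1) => //; apply: eqtr_eulerf.
  apply: eqtrV; rewrite ?unit_opoch ?unitrM ?unitrV ?eulerf_unit // ?fcoef0_qvarX //.
  by apply/eqtr_sym/(@eqtr_le _ n.+1) => //; apply: (@eqtr_opoch 2).
by rewrite fcoef0_qvarX.
Qed.

(** This is psi(-q): signs leave the exponents of psi(q) unchanged. *)
Lemma fcoef_psi_Nq i : (i %% 3 = 2)%N ->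
  fcoef (eulerf 1 ^ 1 * eulerf 2 ^ (-1) * eulerf 4 ^ 1) i = 0.
Proof.
move=> hi; have x0 : fcoef (- qvar) 0 = 0 by rewrite fcoefN oppr0.
apply: (@fcoef_theta_eq0 (- qvar)) => [//|n|k]; last first.
  (* The sign is a constant series, so only j = 0 could contribute, and then i would be
     triangular. *)
  rewrite exprNn -signr_odd fcoefM big1 // => j _.
  rewrite fcoef_qvarX; case: eqP => [jk|]; last by rewrite mulr0.
  case: (posnP j) => [j0|j0].
    by have := bin2_mod3 k; rewrite -jk j0 subn0 hi.
  case: odd; rewrite ?expr0 ?expr1 ?fcoefN fcoef1.
    by case: (nat_of_ord j) j0 => // ?; rewrite oppr0 mul0r.
  by case: (nat_of_ord j) j0 => // ?; rewrite mul0r.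
have -> : opoch (- qvar) n = opoch (qvar ^+ 2) n / opoch qvar n.
  by rewrite -opoch_oppr mulrK // unit_opoch.
rewrite sqrrN !expr1z exprN1.
have -> : eulerf 1 / eulerf 2 * eulerf 4
    = eulerf 2 / (eulerf 2 / eulerf 4 / (eulerf 1 / eulerf 2)).
  transitivity (eulerf 1 / eulerf 2 * eulerf 4 * (eulerf 2 / eulerf 2)).
    by rewrite divrr ?mulr1 // eulerf_unit.
  by rewrite !invrM ?unitrM ?unitrV ?eulerf_unit ?invrK //; ring.
apply: eqtrM; first by apply: (@eqtr_le _ n.+1) => //; apply: eqtr_eulerf.
apply: eqtrV; first by rewrite !(unitrM, unitrV, eulerf_unit).
  by rewrite unitrM unitrV !unit_opoch // fcoef0_qvarX.
have h m : (0 < m)%N -> eqtr n (eulerf m / eulerf (2 * m)) (opoch (qvar ^+ m) n).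
  by move=> m0; apply/eqtr_sym/(@eqtr_le _ n.+1) => //; apply: eqtr_opoch.
apply: eqtrM; first exact: (h 2%N).
apply: eqtrV; rewrite ?unitrM ?unitrV ?unit_opoch ?eulerf_unit //.
by rewrite -[qvar]expr1; apply: h.
Qed.

(** * Cubes modulo 3 *)

(** Cubing is additive in characteristic 3 and fixes the elements of F_3. *)
Lemma cube_polyF3 (p : {poly 'F_3}) : p ^+ 3 = p \Po 'X^3.
Proof.
have c3 : 3%N \in [pchar {poly 'F_3}] by rewrite pchar_poly pchar_Fp.
have cubeF3 (c : 'F_3) : c ^+ 3 = c by apply: val_inj; case: c => [[|[|[|]]]].
elim/poly_ind: p => [|p c IH]; first by rewrite comp_poly0 expr0n.
rewrite -(pFrobenius_autE c3) pFrobenius_autD_comm; last exact: mulrC.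
by rewrite !pFrobenius_autE exprMn IH -polyC_exp cubeF3 comp_poly_MXaddC.
Qed.

(** Truncating a beyond degree n keeps this coefficient, so the polynomial case over F_3 applies. *)
Lemma fcoef_cube (a : fps) n :
  (fcoef (a ^+ 3) n = (if (3 %| n)%N then fcoef a (n %/ 3)%N else 0) %[mod 3])%Z.
Proof.
set p := fps_trunc n.+1 a.
have -> : fcoef (a ^+ 3) n = (p ^+ 3)`_n.
  rewrite !exprS !expr0 !mulr1 (@fps_mul_trunc n.+1) // -/p.
  rewrite ![p * (_ * _)]mulrC [p * fps_trunc _ _]mulrC.
  apply: coefM_eq_trunc => i lein.
  by rewrite coef_poly ltnS lein (@fps_mul_trunc n.+1).
apply/eqP; rewrite eqz_mod_dvd (dvdz_pcharf (pchar_Fp (isT : prime 3))) rmorphB subr_eq0.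
rewrite -coef_map /= rmorphXn /= cube_polyF3 coef_comp_poly_Xn //.
case: ifP => // _; rewrite coef_map coef_poly ifT //.
by rewrite ltnS leq_div.
Qed.

(** The outer cube leads to the coefficient 3n+r of c^3 th. Modulo 3, c^3 has only exponents
    divisible by 3, so th enters at indices congruent to r. *)
Lemma dvd3_fcoef_cubeM (c th : fps) n r : (forall m, (m %% 3 = r)%N -> fcoef th m = 0) ->
  (r < 3)%N -> (3 %| fcoef ((c ^+ 3 * th) ^+ 3) (9 * n + 3 * r))%Z.
Proof.
move=> hth r3.
have -> : (9 * n + 3 * r = 3 * (3 * n + r))%N by lia.
have := fcoef_cube (c ^+ 3 * th) (3 * (3 * n + r)).
rewrite dvdn_mulr // mulKn // => h; apply/dvdz_mod0P; rewrite h.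
apply/dvdz_mod0P; rewrite fcoefM; apply: rpred_sum => i _; have := ltn_ord i => im.
have := fcoef_cube c i; case: ifP => i3 hi; last first.
  by apply: dvdz_mulr; apply/dvdz_mod0P; rewrite hi.
by rewrite hth ?mulr0 ?dvdz0 //; lia.
Qed.

Lemma exprz_D9M (u : fps) (a b : int) : u \is a GRing.unit ->
  u ^ (a * 9 + 3 * b) = ((u ^ a) ^+ 3 * u ^ b) ^+ 3.
Proof.
move=> uu; rewrite exprzDr // exprMn -exprM mulrC [RHS]mulrC; congr (_ * _).
  by rewrite mulrC -exprz_exp.
by rewrite -exprz_exp.
Qed.

Lemma bbar_gfE K R S : bbar_gf K R S = eulerf 1 ^ (- (2 * S%:Z * K%:Z))
  * eulerf 2 ^ ((3 * S%:Z - 2 * R%:Z) * K%:Z) * eulerf 4 ^ ((R%:Z - S%:Z) * K%:Z).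
Proof.
have -> : (R%:Z - S%:Z) * K%:Z = - ((S%:Z - R%:Z) * K%:Z) by ring.
rewrite /bbar_gf invrM ?unitrXz ?eulerf_unit // -!invr_expz; ring.
Qed.

(** Each exponent for 3k components is 3e. Writing e = 3a + x gives 9a + 3x, so only e modulo 3
    matters. *)
Lemma dvd3_gf k R S n r (x y z : int) : (r < 3)%N ->
  (forall i, (i %% 3 = r)%N ->
     fcoef (eulerf 1 ^ x * eulerf 2 ^ y * eulerf 4 ^ z) i = 0) ->
  (- (2 * (S * k)%N%:Z) = x %[mod 3])%Z ->
  (3 * (S * k)%N%:Z - 2 * (R * k)%N%:Z = y %[mod 3])%Z ->
  ((R * k)%N%:Z - (S * k)%N%:Z = z %[mod 3])%Z ->
  (3 %| fcoef (bbar_gf (3 * k) R S) (9 * n + 3 * r))%Z.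
Proof.
move=> r3 hth hx hy hz.
have wit (e w : int) : (e = w %[mod 3])%Z -> exists a, 3 * e = a * 9 + 3 * w.
  by move=> h; exists ((e - w) %/ 3)%Z; lia.
have [a ha] := wit _ _ hx; have [b hb] := wit _ _ hy; have [c hc] := wit _ _ hz.
have -> : bbar_gf (3 * k) R S =
    ((eulerf 1 ^ a * eulerf 2 ^ b * eulerf 4 ^ c) ^+ 3
      * (eulerf 1 ^ x * eulerf 2 ^ y * eulerf 4 ^ z)) ^+ 3.
  rewrite bbar_gfE PoszM.
  have -> : - (2 * S%:Z * (3 * k%:Z)) = a * 9 + 3 * x by rewrite -ha PoszM; ring.
  have -> : (3 * S%:Z - 2 * R%:Z) * (3 * k%:Z) = b * 9 + 3 * y by rewrite -hb !PoszM; ring.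
  have -> : (R%:Z - S%:Z) * (3 * k%:Z) = c * 9 + 3 * z by rewrite -hc !PoszM; ring.
  rewrite !exprz_D9M ?eulerf_unit //.
  move: (eulerf 1 ^ a) (eulerf 2 ^ b) (eulerf 4 ^ c) => A B C.
  move: (eulerf 1 ^ x) (eulerf 2 ^ y) (eulerf 4 ^ z) => X Y Z; ring.
exact: dvd3_fcoef_cubeM.
Qed.

(** * The generating function of overcolored partition tuples *)

Lemma fcoef_bigsum (I : finType) (Q : pred I) (F : I -> fps) n :
  fcoef (\sum_(i | Q i) F i) n = \sum_(i | Q i) fcoef (F i) n.
Proof. by apply: (big_morph (fun a : fps => fcoef a n)) => [//|] /=; rewrite if_same. Qed.

(* The pair mb is (multiplicity, overlining) of one colored part of size s. *)
Definition part_gf n s : fps :=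
  \sum_(mb : 'I_n.+1 * bool) (mb.2 ==> (0 < mb.1)%N)%:R * qvar ^+ (s * mb.1).

(** With y = q^s, multiplicity 0 counts once and each positive one twice, overlined or not: 1 + 2(y
    + ... + y^n). *)
Lemma part_gfE n s :
  (1 - qvar ^+ s) * part_gf n s = 1 + qvar ^+ s - 2 * (qvar ^+ s) ^+ n.+1.
Proof.
have -> : part_gf n s = \sum_(m < n.+1) (1 + (0 < m)%N%:R) * (qvar ^+ s) ^+ m.
  rewrite /part_gf -(pair_big xpredT xpredT
    (fun (m : 'I_n.+1) b => (b ==> (0 < m)%N)%:R * qvar ^+ (s * m))) /=.
  by apply: eq_bigr => m _; rewrite big_bool /= exprM; ring.
elim: n => [|n IH]; first by rewrite big_ord1 /= expr0 expr1; ring.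
by rewrite big_ord_recr /= mulrDr IH [_ ^+ n.+2]exprS; ring.
Qed.

(** The full series 1 + 2y + 2y^2 + ... of one colored part. *)
Definition overq (y : fps) : fps := (1 + y) / (1 - y).

Lemma eqtr_part_gf n s : (0 < s)%N -> eqtr n.+1 (part_gf n s) (overq (qvar ^+ s)).
Proof.
move=> s0; have u1 : 1 - qvar ^+ s \is a GRing.unit.
  by case: s s0 => // s _; apply: unit_1subX.
have -> : part_gf n s = (1 + qvar ^+ s - 2 * (qvar ^+ s) ^+ n.+1) / (1 - qvar ^+ s).
  by rewrite -part_gfE mulrC mulKr.
apply: eqtrM => // i iN.
by rewrite fcoefD fcoefN fcoef_mulX_lt ?oppr0 ?addr0 // fcoef0_qvarX.
Qed.

Lemma eqtr_overq1 n s : (n < s)%N -> eqtr n.+1 (overq (qvar ^+ s)) 1.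
Proof.
move=> ns; have u1 : 1 - qvar ^+ s \is a GRing.unit.
  by case: s ns => // s _; apply: unit_1subX.
rewrite -(divrr u1); apply: eqtrM => // i iN.
by rewrite !fcoefD fcoefN fcoef_qvarX ltn_eqF ?oppr0 //; lia.
Qed.

Lemma natr_forall (A : comPzSemiRingType) (I : finType) (Q : pred I) :
  \prod_i (Q i)%:R = [forall i, Q i]%:R :> A.
Proof.
case: forallP => [h|/forallP]; first by rewrite big1 // => i _; rewrite h.
by rewrite negb_forall => /existsP [i /negbTE hi]; rewrite (bigD1 i) //= hi mul0r.
Qed.

(** Expanding the product picks a multiplicity and an overlining for each colored part; invalid
    picks have coefficient 0. Expanding the K-th power then picks the K components. *)
Lemma card_optuples_fcoef K R S n :
  #|optuples K R S n|%:Z = fcoef ((\prod_(i < n) part_gf n i.+1 ^+ ncolors R S i.+1) ^+ K) n.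
Proof.
pose g (x : cpart R S n) (mb : 'I_n.+1 * bool) : fps :=
  (mb.2 ==> (0 < mb.1)%N)%:R * qvar ^+ (cpart_size x * mb.1).
have -> : \prod_(i < n) part_gf n i.+1 ^+ ncolors R S i.+1 =
    \sum_(p : opart R S n) (opart_valid p)%:R * qvar ^+ opart_weight p.
  transitivity (\prod_(x : cpart R S n) \sum_mb g x mb).
    transitivity (\prod_(i < n) \prod_(j < ncolors R S i.+1) part_gf n i.+1).
      by apply: eq_bigr => i _; rewrite prodr_const card_ord.
    exact: sig_big_dep.
  rewrite bigA_distr_bigA /=; apply: eq_bigr => p _.
  rewrite big_split /= -(big_morph _ (exprD _) (expr0 _)); congr (_ * _).
  by rewrite natr_forall.
rewrite -[X in _ ^+ X](card_ord K) -prodr_const bigA_distr_bigA fcoef_bigsum /=.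
rewrite -sum1_card -natz natr_sum big_mkcond; apply: eq_bigr => P _.
rewrite (_ : \prod_i _ = [forall j, opart_valid (P j)]%:R
  * qvar ^+ (\sum_j opart_weight (P j))%N) ?inE; last first.
  by rewrite big_split /= natr_forall -(big_morph _ (exprD _) (expr0 _)).
case: [forall j, opart_valid (P j)]; last by rewrite mul0r [fcoef _ _]/= if_same.
by rewrite mul1r fcoef_qvarX eq_sym; case: eqP.
Qed.

(** Uses 1 + y = (1 - y^2)/(1 - y). *)
Lemma prod_overq n (y : 'I_n -> fps) : (forall j, fcoef (y j) 0 = 0) ->
  \prod_j overq (y j) = (\prod_j (1 - y j ^+ 2)) / (\prod_j (1 - y j)) ^+ 2.
Proof.
move=> y0; have u j : 1 - y j \is a GRing.unit.
  by rewrite -[y j]expr1; apply: unit_1subX.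
have uP : (\prod_j (1 - y j)) ^+ 2 \is a GRing.unit by rewrite unitrX // unitr_prod_ord.
apply: (mulIr uP); rewrite divrK // -prodrXl -big_split /=; apply: eq_bigr => j _.
by rewrite /overq expr2 mulrA divrK //; ring.
Qed.

Lemma optuples_gf K R S n : #|optuples K R S n|%:Z = fcoef (bbar_gf K R S) n.
Proof.
rewrite card_optuples_fcoef; have /eqtr_sym h : eqtr n.+1 (bbar_gf K R S)
  ((\prod_(i < n) part_gf n i.+1 ^+ ncolors R S i.+1) ^+ K); last exact: h.
apply/eqtr_sym.
(* Sizes above n do not matter; running up to 2 * n pairs each odd size with an even one. *)
pose G := \prod_(i < 2 * n) overq (qvar ^+ i.+1) ^+ ncolors R S i.+1.
(* The contributions, per color, of all odd and of all even sizes. *)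
pose fodd := eulerf 2 / eulerf 4 / (eulerf 1 / eulerf 2) ^+ 2.
pose feven := eulerf 4 / eulerf 2 ^+ 2.
have -> : bbar_gf K R S = (fodd ^+ S * feven ^+ R) ^+ K.
  rewrite bbar_gfE mulrBl [(R%:Z - S%:Z) * _]mulrBl !exprzDr ?eulerf_unit //.
  have -> : fodd = eulerf 2 ^+ 3 * (eulerf 1)^-1 ^+ 2 * (eulerf 4)^-1.
    by rewrite /fodd exprMn invrM ?unitrX ?unitrV ?eulerf_unit // -!exprVn invrK; ring.
  have -> : 2 * S%:Z * K%:Z = (2 * (S * K))%N by lia.
  have -> : 3 * S%:Z * K%:Z = (3 * (S * K))%N by lia.
  have -> : 2 * R%:Z * K%:Z = (2 * (R * K))%N by lia.
  rewrite /feven -exprVn -!PoszM -!invr_expz -!exprnP -!exprVn !exprMn -!exprM.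
  rewrite ![(2 * (_ * _))%N]mulnC ![(3 * (_ * _))%N]mulnC !exprM; ring.
apply: eqtrX; apply: (@eqtr_trans _ G).
  (* Split at n: sizes up to n match [part_gf], larger ones are 1 modulo q^(n+1). *)
  rewrite /G mul2n -addnn big_split_ord /= -[X in eqtr _ X]mulr1.
  apply: eqtrM; first by apply: eqtr_prod => i; apply/eqtrX/eqtr_part_gf.
  apply: eqtr_sym; apply: (@eqtr_trans _ (\prod_(i < n) 1)); last by rewrite big1.
  apply: eqtr_prod => i; rewrite -(expr1n _ (ncolors R S (n + i).+1)).
  by apply/eqtrX/eqtr_overq1; lia.
have -> : G = (opoch (qvar ^+ 2) n / opoch qvar n ^+ 2) ^+ S *
    (poch (qvar ^+ 4) n / poch (qvar ^+ 2) n ^+ 2) ^+ R.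
  have -> : G = \prod_(j < n) (overq (qvar ^+ (2 * j).+1) ^+ S
      * overq ((qvar ^+ 2) ^+ j.+1) ^+ R).
    rewrite /G; elim: (n) => [|N IH]; first by rewrite !big_ord0.
    rewrite mulnS !addSn add0n !big_ord_recr /= IH -mulrA /ncolors /= oddM /=.
    by rewrite -exprM mulnS.
  rewrite big_split !prodrXl !prod_overq => [|j|j].
  - rewrite /opoch /poch; congr ((_ / _) ^+ _ * (_ / _) ^+ _); apply: eq_bigr => j _.
      by rewrite exprAC.
    by rewrite exprAC -[_ ^+ 2 ^+ 2]exprM.
  - by rewrite -exprM mulnS fcoef0_qvarX.
  by rewrite fcoef0_qvarX.
apply: eqtrM; apply: eqtrX; apply: eqtrM.
- exact: (@eqtr_opoch 2).
- apply: eqtrV; first by rewrite unitrX ?unit_opoch.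
    by rewrite unitrX // unitrM unitrV !eulerf_unit.
  by apply: eqtrX; rewrite -[qvar]expr1; apply: eqtr_opoch.
- by apply/eqtr_sym/eqtr_eulerf.
apply: eqtrV; first by rewrite unitrX ?unit_poch ?fcoef0_qvarX.
  by rewrite unitrX ?eulerf_unit.
by apply: eqtrX; apply/eqtr_sym/eqtr_eulerf.
Qed.

(** Unites the count with the convention for a zero index, which the theorem allows for s. *)
Lemma bbarE k r s n : bbar k r s n = fcoef (bbar_gf k r s) n.
Proof. by rewrite /bbar; case: ifP => // _; apply: optuples_gf. Qed.

(** * The congruences modulo 3 *)

(** The exponents -2sk, 3sk-2rk, rk-sk are 0, -1, 2 modulo 3, which selects psi(q^2). *)
Lemma bbar_9n3_mod3 k r s n : (r * k %% 3 = 2)%N -> (s * k %% 3 = 0)%N ->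
  (bbar (3 * k) r s (9 * n + 3) = 0 %[mod 3])%Z.
Proof.
move=> hr hs; rewrite bbarE; apply/eqP; rewrite eqz_mod_dvd subr0.
apply: (@dvd3_gf _ _ _ _ 1 0 (-1) 2) => //; [exact: fcoef_psi_q2 | lia | lia | lia].
Qed.

(** For sk = 2 modulo 3 the exponents are -1, 2, 0, giving psi(q); for sk = 1 they are 1, -1, 1,
    giving psi(-q). *)
Lemma bbar_9n6_mod3 k r s n : (r * k %% 3 = 2)%N -> (s * k %% 3 != 0)%N ->
  (bbar (3 * k) r s (9 * n + 6) = 0 %[mod 3])%Z.
Proof.
move=> hr hs; rewrite bbarE; apply/eqP; rewrite eqz_mod_dvd subr0.
case: (eqVneq (s * k %% 3)%N 2%N) => h2.
  by apply: (@dvd3_gf _ _ _ _ 2 (-1) 2 0) => //; [exact: fcoef_psi_q | lia | lia | lia].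
apply: (@dvd3_gf _ _ _ _ 2 1 (-1) 1) => //; [exact: fcoef_psi_Nq | lia | lia | lia].
Qed.

End Development.

Theorem theorem1p12 (n r s k t u : nat) (ht : (t <= 2)%N) (hu : (u <= 2)%N) :
  ((bbar (9 * k + 3) (9 * r + 3 * t + 2) (9 * s + 3 * u) (9 * n + 3)
      = bbar (9 * k + 6) (9 * r + 3 * t + 1) (9 * s + 3 * u) (9 * n + 3) %[mod 3])%Z
   /\
   (bbar (9 * k + 6) (9 * r + 3 * t + 1) (9 * s + 3 * u) (9 * n + 3)
      = 0 %[mod 3])%Z)
  /\
  ((bbar (9 * k + 3) (9 * r + 3 * t + 2) (9 * s + 3 * u + 2) (9 * n + 6)
      = bbar (9 * k + 6) (9 * r + 3 * t + 1) (9 * s + 3 * u + 1) (9 * n + 6) %[mod 3])%Z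
   /\
   (bbar (9 * k + 6) (9 * r + 3 * t + 1) (9 * s + 3 * u + 1) (9 * n + 6)
      = 0 %[mod 3])%Z)
  /\
  ((bbar (9 * k + 3) (9 * r + 3 * t + 2) (9 * s + 3 * u + 1) (9 * n + 6)
      = bbar (9 * k + 6) (9 * r + 3 * t + 1) (9 * s + 3 * u + 2) (9 * n + 6) %[mod 3])%Z
   /\
   (bbar (9 * k + 6) (9 * r + 3 * t + 1) (9 * s + 3 * u + 2) (9 * n + 6)
      = 0 %[mod 3])%Z).
Proof.
(* A third of the number of components is 1 or 2 modulo 3, and the first lower index is 2 or 1
   respectively, so their product is always 2. *)
have -> : 9 * k + 3 = 3 * (3 * k + 1) by lia.
have -> : 9 * k + 6 = 3 * (3 * k + 2) by lia.
have mod3 a b c d : a %% 3 = c -> b %% 3 = d -> a * b %% 3 = c * d %% 3.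
  by move=> <- <-; rewrite modnMm.
have k1 : (3 * k + 1) %% 3 = 1 by lia.
have k2 : (3 * k + 2) %% 3 = 2 by lia.
have r1 : (9 * r + 3 * t + 1) %% 3 = 1 by lia.
have r2 : (9 * r + 3 * t + 2) %% 3 = 2 by lia.
have s0 : (9 * s + 3 * u) %% 3 = 0 by lia.
have s1 : (9 * s + 3 * u + 1) %% 3 = 1 by lia.
have s2 : (9 * s + 3 * u + 2) %% 3 = 2 by lia.
rewrite !bbar_9n3_mod3 ?(mod3 _ _ _ _ r2 k1) ?(mod3 _ _ _ _ r1 k2)
  ?(mod3 _ _ _ _ s0 k1) ?(mod3 _ _ _ _ s0 k2) //.
by rewrite !bbar_9n6_mod3 ?(mod3 _ _ _ _ r2 k1) ?(mod3 _ _ _ _ r1 k2)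
  ?(mod3 _ _ _ _ s1 k1) ?(mod3 _ _ _ _ s1 k2) ?(mod3 _ _ _ _ s2 k1)
  ?(mod3 _ _ _ _ s2 k2).
Qed.
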